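(* Let $\Gamma$ be a reduced labeled oriented forest (LOF), let $\Gamma_1,\dots,\Gamma_m$ be disjoint sub-LOTs of $\Gamma$, and let $\bar\Gamma$ be the quotient LOF. If $K(\bar\Gamma)$ has the lbf-property, then the pair $(K(\Gamma),\,K(\Gamma_1)\vee\dots\vee K(\Gamma_m))$ has the relative lbf-property.
   Context: **LOGs.** A labeled oriented graph (LOG) $\Gamma=(E,V,s,t,\lambda)$ consists of finite sets $E$ (edges) and $V$ (vertices) and maps $s,t,\lambda\colon E\to V$ (source, target, label). It is a labeled oriented forest (LOF) if the underlying graph (edge $e$ joins $s(e)$ and $t(e)$) is a forest, and a labeled oriented tree (LOT) if the underlying graph is a tree. A sub-LOG $\Gamma_0=(E_0,V_0)\subseteq\Gamma$ is a subgraph with $E_0\neq\emptyset$ and $\lambda(E_0)\subseteq V_0$; it is a sub-LOT if it is a LOT. A LOG is boundary reduced if every vertex $v$ of valency 1 satisfies $v=\lambda(e)$ for some edge $e$. It is interior reduced if for every vertex $v$ no two edges starting or terminating at $v$ carry the same label. It is compressed if $\lambda(e)\ne s(e)$ and $\lambda(e)\neq t(e)$ for every edge $e$. It is reduced if it is boundary reduced, interior reduced and compressed. The LOG complex $K(\Gamma)$ is the standard 2-complex of the presentation $\langle V \mid s(e)\lambda(e)=\lambda(e)t(e),\ e\in E\rangle$: it has one vertex, one oriented edge for each $x\in V$, and for each $e\in E$ a 2-cell attached along $s(e)\lambda(e)t(e)^{-1}\lambda(e)^{-1}$. For disjoint sub-LOTs $\Gamma_i$, $K(\Gamma_1)\vee\dots\vee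 K(\Gamma_m)$ is the union of the subcomplexes $K(\Gamma_i)$ of $K(\Gamma)$, which share only the vertex. **Quotient LOF.** Let $\Gamma_1,\dots,\Gamma_m$ be disjoint sub-LOTs of a LOF $\Gamma$. A quotient LOF $\bar\Gamma$ is obtained as follows: for each $1\le i\le m$ choose a vertex $y_i$ of $\Gamma_i$; whenever $e$ is an edge of $\Gamma$ whose label is a vertex of $\Gamma_i$, relabel $e$ with $y_i$; and collapse $\Gamma_i$ to the vertex $y_i$. **Link.** For a 2-complex $K$ with one vertex and edge set $X=\{x_1,\dots,x_n\}$, the link $lk(K)$ is the undirected (multi)graph with vertices $x_1^+,\dots,x_n^+,x_1^-,\dots,x_n^-$ ($x_i^+$ is near the start and $x_i^-$ near the end of $x_i$), whose edges are the corners of the 2-cells. For $K=K(\Gamma)$, each $e\in E$ with $s(e)=x_i$, $t(e)=x_j$, $\lambda(e)=x_k$ contributes four corners: one joining $x_i^+,x_k^+$, one joining $x_k^-,x_j^-$, one joining $x_i^-,x_k^+$, one joining $x_k^-,x_j^+$. For a set $A$ of vertices of a graph $\Lambda$, $\Lambda(A)$ denotes the full subgraph on $A$. **lbf-property.** With $\Lambda=lk(K)$, $K$ has the lbf-property if there are signs $\epsilon_i\in\{+,-\}$ such that $\Lambda(x_1^{\epsilon_1},\dots,x_n^{\epsilon_n})$ and $\Lambda(x_1^{-\epsilon_1},\dots,x_n^{-\epsilon_n})$ are forests. **Relative lbf-property.** A cycle of edges $e_1\cdots e_k$ in a graph is homology reduced if there is no pair $e_i,e_j$ with $e_j=\bar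 e_i$, where $\bar e_i$ is $e_i$ with reversed orientation. A graph $\Lambda$ is a forest relative to a subgraph $\Lambda'$ (both possibly disconnected) if every homology reduced cycle in $\Lambda$ is contained in $\Lambda'$. Let $K$ be a 2-complex with one vertex and edge set $X=\{x_1,\dots,x_n\}$, and $K_1,\dots,K_m$ mutually edge disjoint subcomplexes with edge sets $X_i\subseteq X$; let $\Lambda=lk(K)$. For a choice of signs $\epsilon_j\in\{+,-\}$ write $\epsilon(x_j)=x_j^{\epsilon_j}$, $-\epsilon(x_j)=x_j^{-\epsilon_j}$. The pair $(K,K_1\vee\dots\vee K_m)$ has the relative lbf-property if there is a choice of $\epsilon$ such that $\Lambda(\epsilon(X))$ is a forest relative to $\bigcup_{i=1}^m\Lambda(\epsilon(X_i))$ and $\Lambda(-\epsilon(X))$ is a forest relative to $\bigcup_{i=1}^m\Lambda(-\epsilon(X_i))$. *)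

(* Defs.v *)
From HB Require Import structures.
From mathcomp Require Import all_boot.

Set Implicit Arguments.
Unset Strict Implicit.
Unset Printing Implicit Defensive.

(** * Finite undirected multigraphs *)

(** Loops and parallel edges are allowed.  The order of the two ends of an edge
    carries no meaning; it only serves to name its two orientations. *)
Record mgraph := MGraph {
  mg_vertex : finType;
  mg_edge : finType;
  mg_end1 : mg_edge -> mg_vertex;
  mg_end2 : mg_edge -> mg_vertex
}.

(** [(e, true)] runs from [mg_end1 e] to [mg_end2 e], [(e, false)] the other
    way.  The two orientations of a loop are thus distinct. *)
Definition oedge (G : mgraph) : finType := (mg_edge G * bool)%type.

Definition initial (G : mgraph) (o : oedge G) : mg_vertex G :=
  if o.2 then mg_end1 o.1 else mg_end2 o.1.

Definition terminal (G : mgraph) (o : oedge G) : mg_vertex G :=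
  if o.2 then mg_end2 o.1 else mg_end1 o.1.

Definition bar (G : mgraph) (o : oedge G) : oedge G := (o.1, ~~ o.2).

Record subgraph (G : mgraph) := Subgraph {
  sg_vertices : {set mg_vertex G};
  sg_edges : {set mg_edge G};
  sg_closed : forall e, e \in sg_edges ->
    (mg_end1 e \in sg_vertices) && (mg_end2 e \in sg_vertices)
}.

Lemma whole_closed (G : mgraph) (e : mg_edge G) : e \in [set: mg_edge G] ->
  (mg_end1 e \in [set: mg_vertex G]) && (mg_end2 e \in [set: mg_vertex G]).
Proof. by rewrite !inE. Qed.

Definition whole (G : mgraph) : subgraph G := Subgraph (@whole_closed G).

Lemma full_closed (G : mgraph) (A : {set mg_vertex G}) (e : mg_edge G) :
  e \in [set e | (mg_end1 e \in A) && (mg_end2 e \in A)] ->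
  (mg_end1 e \in A) && (mg_end2 e \in A).
Proof. by rewrite inE. Qed.

Definition full_subgraph (G : mgraph) (A : {set mg_vertex G}) : subgraph G :=
  Subgraph (@full_closed G A).

Lemma union_closed (G : mgraph) (m : nat) (H : 'I_m -> subgraph G)
    (e : mg_edge G) :
  e \in \bigcup_(i < m) sg_edges (H i) ->
  (mg_end1 e \in \bigcup_(i < m) sg_vertices (H i)) &&
  (mg_end2 e \in \bigcup_(i < m) sg_vertices (H i)).
Proof.
case/bigcupP=> i _ /sg_closed /andP[h1 h2].
by apply/andP; split; apply/bigcupP; exists i.
Qed.

Definition union_subgraph (G : mgraph) (m : nat) (H : 'I_m -> subgraph G) :
  subgraph G := Subgraph (@union_closed G m H).

Definition contained_in (G : mgraph) (H : subgraph G) (c : seq (oedge G)) :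
  bool := all (fun o => o.1 \in sg_edges H) c.

(** A cycle is a nonempty closed edge path; it may revisit vertices and edges. *)
Definition is_cycle (G : mgraph) (H : subgraph G) (c : seq (oedge G)) : bool :=
  [&& c != [::], contained_in H c
    & cycle (fun o o' : oedge G => terminal o == initial o') c].

(** Distinctness of the underlying edges excludes the backtracking path
    [e, bar e]. *)
Definition simple_cycle (G : mgraph) (H : subgraph G) (c : seq (oedge G)) :
  bool :=
  [&& is_cycle H c, uniq [seq initial o | o <- c] & uniq [seq o.1 | o <- c]].

Definition is_forest (G : mgraph) (H : subgraph G) : Prop :=
  forall c : seq (oedge G), ~~ simple_cycle H c.

Definition adjacent (G : mgraph) (H : subgraph G) : rel (mg_vertex G) :=
  fun u v => [exists o : oedge G,
    [&& o.1 \in sg_edges H, initial o == u & terminal o == v]].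

Definition is_tree (G : mgraph) (H : subgraph G) : Prop :=
  [/\ sg_vertices H != set0,
      {in sg_vertices H &, forall u v, connect (adjacent H) u v}
    & is_forest H].

Definition homology_reduced (G : mgraph) (c : seq (oedge G)) : Prop :=
  forall o o' : oedge G, o \in c -> o' \in c -> o' <> bar o.

Definition forest_relative_to (G : mgraph) (H H' : subgraph G) : Prop :=
  forall c : seq (oedge G),
    is_cycle H c -> homology_reduced c -> contained_in H' c.

(** * Finite 2-complexes with a single vertex *)

(** A 2-cell is attached along a cyclic word in the oriented edges;
    [(x, true)] is the letter [x] and [(x, false)] the letter [x^-1]. *)
Record complex2 := Complex2 {
  cx_edge : finType;
  cx_face : finType;
  cx_attach : cx_face -> seq (cx_edge * bool)
}.

Record subcomplex (K : complex2) := Subcomplex {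
  sc_edges : {set cx_edge K};
  sc_faces : {set cx_face K};
  sc_closed : forall f, f \in sc_faces ->
    all (fun a => a.1 \in sc_edges) (cx_attach f)
}.

(** Link vertices: [(x, true)] is [x^+], near the start of [x], and
    [(x, false)] is [x^-], near the end of [x]. *)
Definition link_vertex (K : complex2) : finType := (cx_edge K * bool)%type.

(** The letter [x^-1] departs near the end of [x] and arrives near its start. *)
Definition departure (K : complex2) (a : cx_edge K * bool) : link_vertex K :=
  if a.2 then (a.1, true) else (a.1, false).

Definition arrival (K : complex2) (a : cx_edge K * bool) : link_vertex K :=
  if a.2 then (a.1, false) else (a.1, true).

(** The corner [(f, p)] lies between the letters [p] and [p + 1], taken
    cyclically, of the attaching word of [f]. *)
Definition corner (K : complex2) : finType :=
  {f : cx_face K & 'I_(size (cx_attach f))}.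

Definition corner_in (K : complex2) (c : corner K) : link_vertex K :=
  arrival (tnth (in_tuple (cx_attach (tag c))) (tagged c)).

Definition corner_out (K : complex2) (c : corner K) : link_vertex K :=
  departure (tnth (in_tuple (cx_attach (tag c))) (ordS (tagged c))).

Definition link (K : complex2) : mgraph :=
  MGraph (@corner_in K) (@corner_out K).

(** [signed eps A] is the set of all [x^(eps x)] with [x] in [A]. *)
Definition signed (K : complex2) (eps : cx_edge K -> bool)
    (A : {set cx_edge K}) : {set mg_vertex (link K)} :=
  [set (x, eps x) | x in A].

Definition opposite (K : complex2) (eps : cx_edge K -> bool) :
  cx_edge K -> bool := fun x => ~~ eps x.

Definition lbf (K : complex2) : Prop :=
  exists eps : cx_edge K -> bool,
    is_forest (full_subgraph (signed eps setT)) /\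
    is_forest (full_subgraph (signed (opposite eps) setT)).

Definition edge_disjoint (K : complex2) (m : nat) (L : 'I_m -> subcomplex K) :
  Prop :=
  forall i j : 'I_m, i != j -> [disjoint sc_edges (L i) & sc_edges (L j)].

Definition relative_lbf (K : complex2) (m : nat) (L : 'I_m -> subcomplex K) :
  Prop :=
  edge_disjoint L /\
  exists eps : cx_edge K -> bool,
    forest_relative_to (full_subgraph (signed eps setT))
      (union_subgraph (fun i => full_subgraph (signed eps (sc_edges (L i)))))
    /\
    forest_relative_to (full_subgraph (signed (opposite eps) setT))
      (union_subgraph
         (fun i => full_subgraph (signed (opposite eps) (sc_edges (L i))))).

(** * Labeled oriented graphs *)

Record LOG := MkLOG {
  log_vertex : finType;
  log_edge : finType;
  src : log_edge -> log_vertex;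
  tgt : log_edge -> log_vertex;
  lab : log_edge -> log_vertex
}.

Definition underlying (G : LOG) : mgraph := MGraph (@src G) (@tgt G).

Definition is_LOF (G : LOG) : Prop := is_forest (whole (underlying G)).

Record subLOG (G : LOG) := SubLOG {
  sl_graph :> subgraph (underlying G);
  sl_nonempty : sg_edges sl_graph != set0;
  sl_lab : forall e : log_edge G,
    e \in sg_edges sl_graph -> lab e \in sg_vertices sl_graph
}.

Definition is_subLOT (G : LOG) (S : subLOG G) : Prop := is_tree S.

(** A loop at [v] counts twice. *)
Definition valency (G : LOG) (v : log_vertex G) : nat :=
  #|[set e : log_edge G | src e == v]| + #|[set e : log_edge G | tgt e == v]|.

Definition boundary_reduced (G : LOG) : Prop :=
  forall v : log_vertex G, valency v = 1 -> exists e : log_edge G, v = lab e.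

(** The condition concerns two edges that both start, or both terminate, at the
    same vertex; an incoming and an outgoing edge may share a label. *)
Definition interior_reduced (G : LOG) : Prop :=
  forall e f : log_edge G, e <> f ->
    src e = src f \/ tgt e = tgt f -> lab e <> lab f.

Definition compressed (G : LOG) : Prop :=
  forall e : log_edge G, lab e <> src e /\ lab e <> tgt e.

Definition reduced (G : LOG) : Prop :=
  [/\ boundary_reduced G, interior_reduced G & compressed G].

(** The relator [s(e) lambda(e) t(e)^-1 lambda(e)^-1]. *)
Definition relator (G : LOG) (e : log_edge G) : seq (log_vertex G * bool) :=
  [:: (src e, true); (lab e, true); (tgt e, false); (lab e, false)].

Definition LOG_complex (G : LOG) : complex2 := Complex2 (@relator G).

Lemma subLOG_complex_closed (G : LOG) (S : subLOG G) (e : log_edge G) :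
  e \in sg_edges S ->
  all (fun a => a.1 \in sg_vertices S) (@cx_attach (LOG_complex G) e).
Proof.
by move=> eS; case/andP: (sg_closed eS) => /= -> ->; rewrite (sl_lab eS).
Qed.

Definition subLOG_complex (G : LOG) (S : subLOG G) :
  subcomplex (LOG_complex G) :=
  @Subcomplex (LOG_complex G) (sg_vertices S) (sg_edges S)
    (@subLOG_complex_closed G S).

(** * Quotients by disjoint sub-LOTs *)

Section Quotient.

Variables (G : LOG) (m : nat) (S : 'I_m -> subLOG G) (y : 'I_m -> log_vertex G).

Definition collapse (v : log_vertex G) : log_vertex G :=
  if [pick i | v \in sg_vertices (S i)] is Some i then y i else v.

(** The vertices that survive: those outside every [S i], and the [y i]. *)
Definition kept (v : log_vertex G) : bool :=
  [forall i, v \notin sg_vertices (S i)] || [exists i, v == y i].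

Lemma collapse_kept (v : log_vertex G) : kept (collapse v).
Proof.
rewrite /kept /collapse; case: pickP => [i _ | none].
  by apply/orP; right; apply/existsP; exists i.
by apply/orP; left; apply/forallP=> i; rewrite none.
Qed.

Definition quotient_vertex : finType := {v : log_vertex G | kept v}.

Definition quotient_edge : finType :=
  {e : log_edge G | [forall i, e \notin sg_edges (S i)]}.

Definition project (v : log_vertex G) : quotient_vertex :=
  exist _ (collapse v) (collapse_kept v).

(** Relabeling by [y i] and collapsing [S i] to [y i] are both effected by
    [project]. *)
Definition quotient_LOF : LOG :=
  @MkLOG quotient_vertex quotient_edge
    (fun e => project (src (val e)))
    (fun e => project (tgt (val e)))
    (fun e => project (lab (val e))).

End Quotient.

(* Main.v *)
Require Import Defs.
From mathcomp Require Import all_boot.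

(** Collapsing the sub-LOTs induces a map from the link of K(Gamma) to the link
    of the complex of the quotient LOF.  It sends [x^+] and [x^-] to the same
    sign of the image of [x], it is injective on the corners of the 2-cells
    outside all [S i], and it has no value on the remaining corners.  Give every
    vertex of Gamma the sign that its image has in the quotient.  The sign is
    then constant on each [S i], so the two halves of the link of K(Gamma) are
    mapped to the two halves of the link of the quotient, and each corner of a
    2-cell of some [S i] that lies in a half joins two vertices with the same
    image.

    Hence a homology reduced cycle in one half is mapped, after the corners
    without image are deleted, to a closed walk in a forest which is still
    homology reduced.  A forest has no nonempty such walk
    ([forest_no_homology_reduced_walk]), so every corner of the cycle belongs to
    some [S i], which is the relative forest condition.  The graph-theoretic
    part of this argument is [forest_relative_to_collapse]. *)

Set Implicit Arguments.
Unset Strict Implicit.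
Unset Printing Implicit Defensive.

Fixpoint walk (L : mgraph) (u : mg_vertex L) (c : seq (oedge L))
    (v : mg_vertex L) : bool :=
  if c is o :: c' then (initial o == u) && walk (terminal o) c' v else u == v.

Lemma walk_cat (L : mgraph) (u v : mg_vertex L) (c d : seq (oedge L)) :
  walk u (c ++ d) v = [exists w, walk u c w && walk w d v].
Proof.
elim: c u => [|o c IHc] u /=.
  apply/idP/existsP => [h|[w /andP[/eqP <-]] //].
  by exists u; rewrite eqxx.
rewrite IHc; apply/andP/existsP => [[-> /existsP[w h]]|[w /andP[/andP[-> h] h']]].
  by exists w.
by split=> //; apply/existsP; exists w; rewrite h.
Qed.

Lemma cycle_walk (L : mgraph) (o : oedge L) (c : seq (oedge L)) :
  cycle (fun p q : oedge L => terminal p == initial q) (o :: c) =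
  walk (initial o) (o :: c) (initial o).
Proof.
rewrite /= eqxx /=; move: {1 3}o => p.
by elim: c p => [|q c IHc] p /=; rewrite ?andbT // IHc eq_sym.
Qed.

Lemma homology_reduced_sub (L : mgraph) (c d : seq (oedge L)) :
  {subset d <= c} -> homology_reduced c -> homology_reduced d.
Proof. by move=> sdc hc o o' /sdc ho /sdc; apply: hc. Qed.

Lemma uniq_initial_edges (L : mgraph) (c : seq (oedge L)) :
  homology_reduced c -> uniq [seq initial o | o <- c] ->
  uniq [seq o.1 | o <- c].
Proof.
move=> hc uc; rewrite map_inj_in_uniq; first exact: map_uniq uc.
move=> [e b] [e' b'] oc oc' /= ee'; subst e'.
case: (eqVneq b b') => [-> // | bb'].
by case: (hc _ _ oc oc'); rewrite /bar /=; case: b b' bb' {oc oc'} => [] [].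
Qed.

Lemma non_uniq_map_split (T U : eqType) (f : T -> U) (s : seq T) :
  ~~ uniq (map f s) ->
  exists a x b z d, s = a ++ (x :: b) ++ z :: d /\ f x = f z.
Proof.
elim: s => [//|x s IHs] /=; rewrite negb_and negbK.
case/orP=> [/mapP[z zs fxz]|/IHs[a [x' [b [z [d [-> h]]]]]]].
  by case/splitPr: zs => b d; exists [::], x, b, z, d.
by exists (x :: a), x', b, z, d.
Qed.

(** A shortest nonempty homology reduced closed walk is a simple cycle: a
    repeated initial vertex would cut off a shorter closed subwalk. *)
Lemma forest_no_homology_reduced_walk (L : mgraph) (H : subgraph L)
    (c : seq (oedge L)) (u : mg_vertex L) :
  is_forest H -> contained_in H c -> homology_reduced c -> walk u c u ->
  c = [::].
Proof.
move=> forH; have [n] := ubnP (size c).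
elim: n c u => // n IHn c u szc Hc hc wc.
have [uc | /non_uniq_map_split] := boolP (uniq [seq initial o | o <- c]).
  case: c {szc} => // o c in Hc hc wc uc *.
  case/negP: (forH (o :: c)); rewrite /simple_cycle /is_cycle Hc uc cycle_walk.
  by rewrite uniq_initial_edges //; case/andP: (wc) => /eqP ou _; rewrite ou wc.
case=> [a [x [b [z [d [def_c xz]]]]]]; subst c.
have sub : {subset x :: b <= a ++ (x :: b) ++ z :: d}.
  by move=> o ob; rewrite !mem_cat ob orbT.
suff: x :: b = [::] by [].
apply: (IHn _ (initial x)).
- move: szc; rewrite ltnS; apply: leq_trans.
  by rewrite !size_cat /= !(addnS, addSn) !ltnS addnCA leq_addr.
- by apply/allP => o /sub; apply: (allP Hc).
- exact: homology_reduced_sub sub hc.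
move: wc; rewrite walk_cat => /existsP[w /andP[_]].
rewrite walk_cat => /existsP[w' /andP[wb /= /andP[/eqP zw' _]]].
by case/andP: wb => _ wb; rewrite /= eqxx xz zw'.
Qed.

(** The partial map [g] on edges is undefined on the edges to be collapsed. *)
Definition map_oedge (L L' : mgraph) (g : mg_edge L -> option (mg_edge L'))
    (o : oedge L) : option (oedge L') :=
  omap (fun d => (d, o.2)) (g o.1).

(** If [f] and [g] describe a graph map which contracts edges of [H0] only and
    is injective on the other edges, then a homology reduced cycle of [H]
    leaving [H0] would have a nonempty homology reduced image. *)
Lemma forest_relative_to_collapse (L L' : mgraph) (H H0 : subgraph L)
    (H' : subgraph L') (f : mg_vertex L -> mg_vertex L')
    (g : mg_edge L -> option (mg_edge L')) :
  (forall e e' d, g e = Some d -> g e' = Some d -> e = e') ->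
  (forall e d, g e = Some d ->
     mg_end1 d = f (mg_end1 e) /\ mg_end2 d = f (mg_end2 e)) ->
  (forall e d, e \in sg_edges H -> g e = Some d -> d \in sg_edges H') ->
  (forall e, e \in sg_edges H -> g e = None ->
     f (mg_end1 e) = f (mg_end2 e) /\ e \in sg_edges H0) ->
  is_forest H' -> forest_relative_to H H0.
Proof.
move=> g_inj g_end gH g_none forH' c /and3P[c0 Hc cyc] hc.
have walk_map d u v : contained_in H d -> walk u d v ->
    walk (f u) (pmap (map_oedge g) d) (f v).
  elim: d u => [|[e b] d IHd] u /=; first by move=> _ /eqP->.
  case/andP=> eH dH /andP[/eqP <- /(IHd _ dH)]; rewrite /map_oedge /=.
  case ge: (g e) => [d'|] /=; last first.
    have [fe _] := g_none _ eH ge.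
    by case: b; rewrite /terminal /initial /= fe.
  have [e1 e2] := g_end _ _ ge.
  by case: b; rewrite /terminal /initial /= e1 e2 eqxx.
have image_nil : pmap (map_oedge g) c = [::].
  have mem_image o : o \in pmap (map_oedge g) c ->
      exists2 e, (e, o.2) \in c & g e = Some o.1.
    rewrite mem_pmap => /mapP[[e b] ec]; rewrite /map_oedge /=.
    by case ge: (g e) => [d|] //= [->]; exists e.
  case: c => // o c in c0 Hc cyc hc mem_image *.
  apply: (@forest_no_homology_reduced_walk _ H' _ (f (initial o))) => //.
  - apply/allP => p /mem_image[e ec]; apply: gH; exact: (allP Hc _ ec).
  - move=> p p' /mem_image[e ec ge] /mem_image[e' ec' ge'] pp'.
    rewrite pp' /= in ec' ge'; rewrite (g_inj _ _ _ ge' ge) in ec'.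
    exact: (hc _ _ ec ec').
  by apply: walk_map => //; rewrite -cycle_walk.
apply/allP => o oc.
have oH := allP Hc _ oc.
case go: (g o.1) => [d|]; last by have [] := g_none _ oH go.
have : (d, o.2) \in pmap (map_oedge g) c.
  by rewrite mem_pmap; apply/mapP; exists o; rewrite // /map_oedge go.
by rewrite image_nil.
Qed.

Lemma mem_signed (K : complex2) (eps : cx_edge K -> bool)
    (A : {set cx_edge K}) (x : link_vertex K) :
  (x \in signed eps A) = (x.1 \in A) && (x.2 == eps x.1).
Proof.
apply/imsetP/andP => [[z zA ->] //|[xA /eqP xe]]; exists x.1 => //.
by rewrite -xe; case: x {xA xe}.
Qed.

Section CollapseLink.

Variables (G : LOG) (m : nat) (S : 'I_m -> subLOG G) (y : 'I_m -> log_vertex G).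

Let Q := quotient_LOF S y.
Let pr : log_vertex G -> log_vertex Q := project S y.

Definition link_project (x : mg_vertex (link (LOG_complex G))) :
  mg_vertex (link (LOG_complex Q)) := (pr x.1, x.2).

Definition corner_project (c : mg_edge (link (LOG_complex G))) :
  option (mg_edge (link (LOG_complex Q))) :=
  omap (fun e : log_edge Q =>
     (* all attaching words have length 4, so the position can be reused *)
     existT (fun e => 'I_(size (@cx_attach (LOG_complex Q) e))) e
       (tagged c : 'I_4))
    (insub (tag c)).

Lemma corner_project_inj c c' d :
  corner_project c = Some d -> corner_project c' = Some d -> c = c'.
Proof.
case: c c' => [e p] [e' p']; rewrite /corner_project /=.
case: insubP => //= q _ <- [<-]; case: insubP => //= q' _ <- [qq'].
rewrite -{}qq' in p *; move=> pp'.
have -> // : p = p'.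
by apply/val_inj; rewrite /= pp'.
Qed.

Lemma corner_project_ends c d : corner_project c = Some d ->
  mg_end1 d = link_project (mg_end1 c) /\
  mg_end2 d = link_project (mg_end2 c).
Proof.
case: c => [e p]; rewrite /corner_project /=.
case: insubP => //= q _ <- [<-].
rewrite /corner_in /corner_out /link_project /arrival /departure /=.
rewrite !(tnth_nth (pr (src (val q)), true)) !(tnth_nth (src (val q), true)) /=.
by case: p => [[|[|[|[|p]]]] lt_p].
Qed.

Hypothesis disjS : forall i j : 'I_m, i != j ->
  [disjoint sg_vertices (S i) & sg_vertices (S j)].

Lemma project_sub i u v :
  u \in sg_vertices (S i) -> v \in sg_vertices (S i) -> pr u = pr v.
Proof.
have collapse_sub w : w \in sg_vertices (S i) -> collapse S y w = y i.
  move=> wi; rewrite /collapse; case: pickP => [j wj | /(_ i)]; last by rewrite wi.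
  by case: (eqVneq j i) => [-> // | /disjS/disjointFr/(_ wj)]; rewrite wi.
by move=> ui vi; apply: val_inj; rewrite /= !collapse_sub.
Qed.

Lemma corner_ends_sub i (c : mg_edge (link (LOG_complex G))) :
  tag c \in sg_edges (S i) ->
  ((mg_end1 c).1 \in sg_vertices (S i)) && ((mg_end2 c).1 \in sg_vertices (S i)).
Proof.
case: c => e p /= ei; have /andP[/= si ti] := @sg_closed _ (S i) _ ei.
have li := sl_lab ei.
rewrite /corner_in /corner_out /arrival /departure !(tnth_nth (src e, true)) /=.
by case: p => [[|[|[|[|p]]]] lt_p] //=; rewrite ?si ?ti ?li.
Qed.

(** Each half of the link is treated by the same argument, as the sign
    opposite to a sign pulled back from the quotient is again pulled back. *)
Lemma half_link_forest_relative (eps : log_vertex Q -> bool) :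
  is_forest (full_subgraph (@signed (LOG_complex Q) eps setT)) ->
  forest_relative_to
    (full_subgraph (@signed (LOG_complex G) (fun v => eps (pr v)) setT))
    (union_subgraph (fun i => full_subgraph
       (@signed (LOG_complex G) (fun v => eps (pr v))
          (sc_edges (subLOG_complex (S i)))))).
Proof.
apply: (forest_relative_to_collapse (f := link_project) (g := corner_project)).
- exact: corner_project_inj.
- exact: corner_project_ends.
- move=> c d; rewrite !inE !mem_signed => h /corner_project_ends[-> ->].
  by move: h; rewrite !inE.
move=> c; rewrite inE !mem_signed !inE /= => /andP[/eqP e1 /eqP e2].
rewrite /corner_project; case: insubP => //= /forallPn[i /negPn ci] _.
have /andP[i1 i2] := corner_ends_sub ci.
have p12 := project_sub i1 i2; split; first by rewrite /link_project e1 e2 p12.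
apply/bigcupP; exists i => //.
rewrite inE; apply/andP; split.
  by apply: etrans (mem_signed _ _ _) _; rewrite i1 e1 eqxx.
by apply: etrans (mem_signed _ _ _) _; rewrite i2 e2 eqxx.
Qed.

End CollapseLink.

Theorem theorem8p3 (G : LOG) (m : nat) (S : 'I_m -> subLOG G)
    (y : 'I_m -> log_vertex G) :
  is_LOF G ->
  reduced G ->
  (forall i : 'I_m, is_subLOT (S i)) ->
  (forall i j : 'I_m, i != j ->
     [disjoint sg_vertices (S i) & sg_vertices (S j)]) ->
  (forall i : 'I_m, y i \in sg_vertices (S i)) ->
  lbf (LOG_complex (quotient_LOF S y)) ->
  relative_lbf (fun i : 'I_m => subLOG_complex (S i)).
Proof.
move=> _ _ _ disjS _ [eps [forP forN]]; split; first exact: disjS.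
exists (fun v => eps (project S y v)); split.
  exact: half_link_forest_relative disjS _ forP.
exact: half_link_forest_relative disjS _ forN.
Qed.
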